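(* Consider the conjugate gradient (CG) or conjugate residual (CR) method with $N\ge 1$ iterations, step sizes $\alpha_j$ and norms $\|q_j\|$, $0\le j\le N-1$, where $\alpha_j\|q_j\|>0$ for all $j$. Assume that the method has the diminishing returns property $$\alpha_{j-1}^2\|q_{j-1}\|^2>\alpha_j^2\|q_j\|^2\qquad\text{for every } 1\le j\le N-1 .$$ Let $C$ be a given average number of iterations, $0<C\le N$. Then the AS estimator with average number of iterations $C$ solves the variance minimization problem; that is, there is an AS truncation distribution $\mathbb{P}$ with $\sum_{j=0}^N j\,\mathbb{P}(j)=C$, and such a distribution is a global minimizer of $$\min_{\mathbb{P}}\ \sum_{j=0}^{N}\mathbb{P}(j)\,\|v_j\|^2\quad\text{s.t.}\quad \sum_{j=0}^N j\,\mathbb{P}(j)=C,\quad \sum_{j=0}^N\mathbb{P}(j)=1,\quad \mathbb{P}(j)\ge 0\ \ (0\le j\le N).$$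
   Context: Krylov methods. CG for a symmetric positive definite system $Ax=b$ of dimension $N$: $r_0=b-Ax_0$, $p_0=r_0$, and for $j=0,1,\dots$: $\alpha_j=(r_j,r_j)/(Ap_j,p_j)$, $x_{j+1}=x_j+\alpha_jp_j$, $r_{j+1}=r_j-\alpha_jAp_j$, $\beta_j=(r_{j+1},r_{j+1})/(r_j,r_j)$, $p_{j+1}=r_{j+1}+\beta_jp_j$. CR for a Hermitian system is the same recursion with $\alpha_j=(r_j,Ar_j)/(Ap_j,Ap_j)$ and $\beta_j=(r_{j+1},Ar_{j+1})/(r_j,Ar_j)$. Write $\|q_j\|=\|p_j\|_A=\sqrt{p_j^\top Ap_j}$ for CG and $\|q_j\|=\|Ap_j\|_2$ for CR. The statement involves the method only through the numbers $\alpha_j\|q_j\|$, $0\le j\le N-1$. Randomized truncation. $\mathbb{P}(j)$, $0\le j\le N$, is the probability of truncating before the $j$-th iteration ($\mathbb{P}(N)$ is the probability of performing all $N$ iterations, numbered $0,\dots,N-1$). The squared error (squared energy norm of the error for CG, squared 2-norm of the residual for CR) of the reweighted (Russian Roulette) iterate before iteration $j$ is $$\|v_j\|^2=\sum_{k=0}^{j-1}\left(\alpha_k-\frac{\alpha_k}{1-\sum_{i=0}^k\mathbb{P}(i)}\right)^2\|q_k\|^2+\sum_{k=j}^{N-1}\alpha_k^2\|q_k\|^2,\qquad 0\le j\le N,$$ with empty sums equal to $0$. The objective $\sum_j\mathbb{P}(j)\|v_j\|^2$ is taken to be $+\infty$ when $\mathbb{P}(N)=0$ (where a denominator vanishes).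 AS estimator. For a parameter $\eta\in(-1,N-1)$ put $n=\lfloor\eta\rfloor$, $\sigma=\eta-n$. The AS truncation distribution is - $\mathbb{P}(j)=0$ for $0\le j\le n$; - $\mathbb{P}(n+1)=1-\sigma$ if $n=-1$, and $\mathbb{P}(n+1)=(1-\sigma)\dfrac{\alpha_n\|q_n\|-\alpha_{n+1}\|q_{n+1}\|}{\alpha_n\|q_n\|}$ if $n\ge 0$; - $\mathbb{P}(j)=\dfrac{(\alpha_{j-1}\|q_{j-1}\|-\alpha_j\|q_j\|)(1-\mathbb{P}(n+1))}{\alpha_{n+1}\|q_{n+1}\|}$ for $n+1<j\le N-1$; - $\mathbb{P}(N)=\dfrac{\alpha_{N-1}\|q_{N-1}\|\,(1-\mathbb{P}(n+1))}{\alpha_{n+1}\|q_{n+1}\|}$. In addition, the case $n=N-1$ is the deterministic method: $\mathbb{P}(j)=0$ for $0\le j\le N-1$ and $\mathbb{P}(N)=1$, with average number of iterations $N$; it is also counted as an AS truncation distribution. The average number of iterations of $\mathbb{P}$ is $\sum_{j=0}^N j\,\mathbb{P}(j)$. *)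

(* Defs.v *)
(* MathComp, with the real numbers (realType) and extended reals (\bar R) of
   MathComp-Analysis and the complex numbers R[i] of mathcomp-real-closed. *)
From mathcomp Require Import all_boot all_order all_algebra.
From mathcomp Require Import complex.
From mathcomp Require Import reals constructive_ereal.

Set Implicit Arguments.
Unset Strict Implicit.
Unset Printing Implicit Defensive.

Import Order.TTheory GRing.Theory Num.Theory.
Local Open Scope ring_scope.

Record krylov_state (F : fieldType) (N : nat) := KrylovState {
  iterate : 'cV[F]_N;
  residual : 'cV[F]_N;
  direction : 'cV[F]_N
}.

(* The recursion common to CG and CR: the methods only differ by [num] and
   [den], with alpha_j = num r_j / den p_j and beta_j = num r_{j+1} / num r_j. *)
Definition krylov_alpha (F : fieldType) (N : nat) (num den : 'cV[F]_N -> F)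
    (s : krylov_state F N) : F :=
  num (residual s) / den (direction s).

Definition krylov_step (F : fieldType) (N : nat) (A : 'M[F]_N)
    (num den : 'cV[F]_N -> F) (s : krylov_state F N) : krylov_state F N :=
  let alpha := krylov_alpha num den s in
  let r := residual s - alpha *: (A *m direction s) in
  let beta := num r / num (residual s) in
  KrylovState (iterate s + alpha *: direction s) r (r + beta *: direction s).

Definition krylov_run (F : fieldType) (N : nat) (A : 'M[F]_N)
    (b x0 : 'cV[F]_N) (num den : 'cV[F]_N -> F) (j : nat) : krylov_state F N :=
  iter j (krylov_step A num den)
    (KrylovState x0 (b - A *m x0) (b - A *m x0)).

Definition dotR (R : realType) (N : nat) (u v : 'cV[R]_N) : R :=
  (u^T *m v) 0 0.

Definition dotC (R : realType) (N : nat) (u v : 'cV[R[i]]_N) : R[i] :=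
  (map_mx Num.conj (u^T) *m v) 0 0.

Definition spd (R : realType) (N : nat) (A : 'M[R]_N) : Prop :=
  A \is symmetricmx /\ (forall x : 'cV[R]_N, x != 0 -> 0 < dotR x (A *m x)).

Section ConjugateGradient.
Variables (R : realType) (N : nat) (A : 'M[R]_N) (b x0 : 'cV[R]_N).

Definition cg_num (r : 'cV[R]_N) : R := dotR r r.
Definition cg_den (p : 'cV[R]_N) : R := dotR (A *m p) p.
Definition cg (j : nat) : krylov_state R N := krylov_run A b x0 cg_num cg_den j.
Definition cg_alpha (j : nat) : R := krylov_alpha cg_num cg_den (cg j).
Definition cg_normq (j : nat) : R :=
  let p := direction (cg j) in Num.sqrt (dotR p (A *m p)).

End ConjugateGradient.

(* For Hermitian A, num, den and hence alpha_j are real numbers embedded in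
   R[i]; [complex.Re] only retypes them. *)
Section ConjugateResidual.
Variables (R : realType) (N : nat) (A : 'M[R[i]]_N) (b x0 : 'cV[R[i]]_N).

Definition cr_num (r : 'cV[R[i]]_N) : R[i] := dotC r (A *m r).
Definition cr_den (p : 'cV[R[i]]_N) : R[i] := dotC (A *m p) (A *m p).
Definition cr (j : nat) : krylov_state R[i] N :=
  krylov_run A b x0 cr_num cr_den j.
Definition cr_alpha (j : nat) : R :=
  complex.Re (krylov_alpha cr_num cr_den (cr j)).
Definition cr_normq (j : nat) : R :=
  let p := direction (cr j) in Num.sqrt (complex.Re (dotC (A *m p) (A *m p))).

End ConjugateResidual.

Inductive krylov_method (R : realType) (N : nat) :=
  | CG (A : 'M[R]_N) (b x0 : 'cV[R]_N) of spd A
  | CR (A : 'M[R[i]]_N) (b x0 : 'cV[R[i]]_N) of A \is hermsymmx.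

Definition step_size (R : realType) (N : nat) (m : krylov_method R N)
    (j : nat) : R :=
  match m with
  | CG A b x0 _ => cg_alpha A b x0 j
  | CR A b x0 _ => cr_alpha A b x0 j
  end.

Definition q_norm (R : realType) (N : nat) (m : krylov_method R N)
    (j : nat) : R :=
  match m with
  | CG A b x0 _ => cg_normq A b x0 j
  | CR A b x0 _ => cr_normq A b x0 j
  end.

(* A truncation distribution is given by a function P : nat -> R of which only
   the values P 0, ..., P N are ever used. *)
Section Truncation.
Variables (R : realType) (N : nat) (alpha q : nat -> R).

Definition avg_iterations (P : nat -> R) : R :=
  \sum_(0 <= j < N.+1) j%:R * P j.

Definition truncation_err2 (P : nat -> R) (j : nat) : R :=
  \sum_(0 <= k < j)
     (alpha k - alpha k / (1 - \sum_(0 <= i < k.+1) P i)) ^+ 2 * q k ^+ 2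
  + \sum_(j <= k < N) alpha k ^+ 2 * q k ^+ 2.

Definition objective (P : nat -> R) : \bar R :=
  if P N == 0 then +oo%E
  else (\sum_(0 <= j < N.+1) P j * truncation_err2 P j)%:E.

Definition feasible (C : R) (P : nat -> R) : Prop :=
  [/\ avg_iterations P = C,
      \sum_(0 <= j < N.+1) P j = 1
    & forall j, (j <= N)%N -> 0 <= P j].

Definition global_minimizer (C : R) (P : nat -> R) : Prop :=
  feasible C P /\
  (forall Q : nat -> R, feasible C Q -> (objective P <= objective Q)%E).

(* Intended for -1 < eta < N - 1.  Since floor eta may be -1, indices are
   expressed through the natural number m = floor eta + 1. *)
Definition as_distribution (eta : R) (j : nat) : R :=
  let a k := alpha k * q k in
  let n : int := Num.floor eta in
  let sigma := eta - n%:~R in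
  let m : nat := absz (n + 1) in
  let Pm := if n == -1 then 1 - sigma
            else (1 - sigma) * ((a m.-1 - a m) / a m.-1) in
  if (j < m)%N then 0
  else if j == m then Pm
  else if (j < N)%N then (a j.-1 - a j) * (1 - Pm) / a m
  else a N.-1 * (1 - Pm) / a m.

Definition is_as_distribution (P : nat -> R) : Prop :=
  (exists eta : R, [/\ -1 < eta, eta < N%:R - 1
     & forall j, (j <= N)%N -> P j = as_distribution eta j])
  \/ (forall j, (j <= N)%N -> P j = (j == N)%:R).

End Truncation.

(* Main.v *)
Require Import Defs.
From mathcomp Require Import all_boot all_order all_algebra.
From mathcomp Require Import reals constructive_ereal.
From mathcomp Require Import ring lra.

Set Implicit Arguments.
Unset Strict Implicit.
Unset Printing Implicit Defensive.

Import Order.TTheory GRing.Theory Num.Theory.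
Local Open Scope ring_scope.

(** Only the products a_k = alpha_k ||q_k|| matter.  Let s_k be the probability
    that iteration k is performed, i.e. that the truncation index exceeds k.
    Summation by parts in j turns the average number of iterations into
    [sum_k s_k] ([avg_iterations_survival]) and the objective into
    [sum_k a_k^2 (1/s_k - 1)] ([objectiveE]).  So the problem is to minimize a
    separable convex function of the numbers s_k in ]0, 1], whose sum is
    prescribed.

    The KKT conditions of this problem are those of water filling: the solution
    is s_k = min(1, t a_k), where t > 0 is fixed by the sum of the s_k.  Its
    optimality ([waterfill_optimal]) follows from the tangent of x |-> a_k^2 / x
    at s_k: where s_k < 1 the slope is -1/t^2, the same for all k, and where
    s_k = 1 it is at most -1/t^2 while competitors can only lie to the left of
    1.  As the a_k decrease, these s_k are nonincreasing, hence they come from a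
    probability distribution.

    It remains to see that the AS distributions are exactly the water-filling
    ones.  The number of saturated s_k changes when t crosses one of the values
    1/a_0 < 1/a_1 < ... < 1/a_(N-1); these, and 0, are the breakpoints below.
    The AS parameter eta is the piecewise linear coordinate on this grid: with
    m = floor eta + 1, the distribution with parameter eta = m - 1 + sigma has
    t = (1 - sigma) / a_(m-1) + sigma / a_m, where 1/a_(-1) stands for 0
    ([as_distribution_waterfill]); the deterministic method is t = 1/a_(N-1).
    Between two breakpoints every min(1, t a_k) is affine in t, so the average
    number of iterations is piecewise linear in eta, going from 0 to N.  Every
    C in ]0, N[ is thus reached by interpolating between the first breakpoint
    with average above C and its predecessor ([exists_interp_sum]). *)

(** * Objective and average as functions of the survival probabilities *)

(** The probability that iteration k is performed, in the form in which it
    occurs as a denominator of the reweighted error. *)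
Definition survival (R : pzRingType) (P : nat -> R) (k : nat) : R :=
  1 - \sum_(0 <= i < k.+1) P i.

(** Exchanging the sums over j and k: iteration k contributes [f k] for the
    truncation indices above k and [g k] for the others. *)
Lemma partial_summation (R : comPzRingType) (N : nat) (P f g : nat -> R) :
  \sum_(0 <= j < N.+1) P j * (\sum_(0 <= k < j) f k + \sum_(j <= k < N) g k)
  = \sum_(0 <= k < N)
      (f k * (\sum_(0 <= j < N.+1) P j - \sum_(0 <= i < k.+1) P i)
       + g k * \sum_(0 <= i < k.+1) P i).
Proof.
elim: N => [|N IHN]; first by rewrite big_nat1 !big_geq // addr0 mulr0.
rewrite big_nat_recr //= [in RHS]big_nat_recr //=.
rewrite (big_geq (leqnn N.+1)) addr0.
rewrite (eq_big_nat _ _ (F2 := fun j =>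
  P j * (\sum_(0 <= k < j) f k + \sum_(j <= k < N) g k) + P j * g N)); last first.
  by move=> j /andP[_ jN]; rewrite big_nat_recr //=; ring.
rewrite big_split /= IHN -mulr_suml.
rewrite [in RHS](eq_bigr (fun k =>
  (f k * (\sum_(0 <= j < N.+1) P j - \sum_(0 <= i < k.+1) P i)
   + g k * \sum_(0 <= i < k.+1) P i) + P N.+1 * f k)); last first.
  by move=> k _; rewrite (big_nat_recr N.+1) //=; ring.
rewrite [in RHS]big_split /= -mulr_sumr (big_nat_recr N.+1 0 P) //=.
by rewrite (big_nat_recr N 0 f) //=; ring.
Qed.

Lemma avg_iterations_survival (R : realType) (N : nat) (P : nat -> R) :
  \sum_(0 <= j < N.+1) P j = 1 ->
  avg_iterations N P = \sum_(0 <= k < N) survival P k.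
Proof.
move=> P1; have := partial_summation N P (fun=> 1) (fun=> 0).
rewrite P1 => {P1}E; rewrite /avg_iterations.
under eq_bigr => j _.
  rewrite mulrC (_ : j%:R = \sum_(0 <= k < j) 1 + \sum_(j <= k < N) 0); last first.
    by rewrite big1_eq addr0 sumr_const_nat subn0.
  over.
by rewrite /= E; apply: eq_bigr => k _; rewrite mul1r mul0r addr0.
Qed.

Lemma survivalE (R : pzRingType) (N : nat) (P : nat -> R) (k : nat) :
  \sum_(0 <= j < N.+1) P j = 1 -> (k <= N)%N ->
  survival P k = \sum_(k.+1 <= j < N.+1) P j.
Proof.
move=> P1 kN; rewrite /survival -P1 (big_cat_nat _ (n := k.+1)) //=.
by rewrite addrAC subrr add0r.
Qed.

Lemma survival_le1 (R : numDomainType) (N : nat) (P : nat -> R) (k : nat) :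
  (forall j, (j <= N)%N -> 0 <= P j) -> (k <= N)%N -> survival P k <= 1.
Proof.
move=> P0 kN; rewrite lerBlDr lerDl big_nat sumr_ge0 // => i /andP[_ ik].
by apply: P0; apply: leq_trans kN.
Qed.

Lemma survival_gt0 (R : numDomainType) (N : nat) (P : nat -> R) (k : nat) :
  \sum_(0 <= j < N.+1) P j = 1 -> (forall j, (j <= N)%N -> 0 <= P j) ->
  P N != 0 -> (k < N)%N -> 0 < survival P k.
Proof.
move=> P1 P0 PN kN; rewrite (survivalE P1) ?(ltnW kN) // big_nat_recr //=.
rewrite ltr_wpDl ?lt_def ?PN ?P0 // big_nat sumr_ge0 // => i /andP[_ iN].
by apply: P0; apply: ltnW.
Qed.

(** Iteration k contributes a_k^2 (1 - 1/s_k)^2 with probability s_k and a_k^2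
    with probability 1 - s_k, and s (1 - 1/s)^2 + (1 - s) = 1/s - 1. *)
Lemma objectiveE (R : realType) (N : nat) (alpha q P : nat -> R) :
  \sum_(0 <= j < N.+1) P j = 1 -> (forall j, (j <= N)%N -> 0 <= P j) ->
  P N != 0 ->
  objective N alpha q P =
  (\sum_(0 <= k < N) (alpha k * q k) ^+ 2 * ((survival P k)^-1 - 1))%:E.
Proof.
move=> P1 P0 PN; rewrite /objective (negbTE PN) /truncation_err2.
rewrite partial_summation P1; congr (_ %:E).
apply: eq_big_nat => k /andP[_ kN]; rewrite -/(survival P k).
have := survival_gt0 P1 P0 PN kN.
have -> : \sum_(0 <= i < k.+1) P i = 1 - survival P k by rewrite /survival; ring.
by move=> s0; field; rewrite gt_eqF.
Qed.

(** * Water filling *)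

Section WaterFilling.
Variables (R : realFieldType) (N : nat) (a : nat -> R).
Hypothesis a_gt0 : forall k, (k < N)%N -> 0 < a k.
Hypothesis a_anti : forall j k, (j <= k)%N -> (k < N)%N -> a k <= a j.

Definition level (t : R) (k : nat) : R := Num.min 1 (t * a k).

(** The levels shifted by one index and completed by the boundary values 1 and
    0: the probability that the truncation index is at least j. *)
Definition level_ext (t : R) (j : nat) : R :=
  if j is k.+1 then if (k < N)%N then level t k else 0 else 1.

Definition waterfill (t : R) (j : nat) : R := level_ext t j - level_ext t j.+1.

Lemma sum_waterfill (t : R) (n : nat) :
  \sum_(0 <= j < n) waterfill t j = 1 - level_ext t n.
Proof.
rewrite -[RHS]opprB -[1]/(level_ext t 0) -telescope_sumr // -sumrN.
by apply: eq_bigr => j _; rewrite opprB.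
Qed.

Lemma survival_waterfill (t : R) (k : nat) :
  (k < N)%N -> survival (waterfill t) k = level t k.
Proof. by move=> kN; rewrite /survival sum_waterfill /= kN; ring. Qed.

Lemma waterfill_ge0 (t : R) (j : nat) :
  0 <= t -> (j <= N)%N -> 0 <= waterfill t j.
Proof.
move=> t0 jN; rewrite subr_ge0; case: j jN => [|j] jN /=.
  by case: ifP => // _; rewrite ge_min lexx.
rewrite jN; case: ifP => [j1N|_].
  rewrite le_min !ge_min lexx /= ler_wpM2l ?orbT //.
  exact: a_anti.
by rewrite le_min ler01 /= mulr_ge0 // ltW // a_gt0.
Qed.

Lemma level_gt0 (t : R) (k : nat) : 0 < t -> (k < N)%N -> 0 < level t k.
Proof. by move=> t0 kN; rewrite lt_min ltr01 mulr_gt0 ?a_gt0. Qed.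

(** The convex function x |-> a_k^2 / x lies above its tangent at the level s_k.
    The tangent has slope -1/t^2 where s_k < 1, and one that is at most -1/t^2
    where s_k = 1; there u_k <= s_k, so the tangent, and with it the function,
    still lies above the line of slope -1/t^2. *)
Lemma waterfill_optimal (t : R) (u : nat -> R) :
  0 < t -> (forall k, (k < N)%N -> 0 < u k <= 1) ->
  \sum_(0 <= k < N) u k = \sum_(0 <= k < N) level t k ->
  \sum_(0 <= k < N) a k ^+ 2 * ((level t k)^-1 - 1)
  <= \sum_(0 <= k < N) a k ^+ 2 * ((u k)^-1 - 1).
Proof.
move=> t0 uP us.
(* As the slope is the same for all k, the linear terms cancel in the sum. *)
suff tangent k : (k < N)%N ->
    a k ^+ 2 * ((level t k)^-1 - 1) - t ^- 2 * (u k - level t k)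
    <= a k ^+ 2 * ((u k)^-1 - 1).
  have -> : \sum_(0 <= k < N) a k ^+ 2 * ((level t k)^-1 - 1) =
      \sum_(0 <= k < N)
        (a k ^+ 2 * ((level t k)^-1 - 1) - t ^- 2 * (u k - level t k)).
    by rewrite sumrB -mulr_sumr sumrB us subrr mulr0 subr0.
  by rewrite big_nat [leRHS]big_nat; apply: ler_sum => k /andP[_]; exact: tangent.
move=> kN; have /andP[u0 u1] := uP k kN; have ak := a_gt0 kN.
(* In each case the difference factors into manifestly nonnegative terms; in
   the saturated case -1/t^2 is only an upper bound for the slope at 1. *)
rewrite -subr_ge0 /level; case: (leP 1 (t * a k)) => tak.
  suff -> : a k ^+ 2 * ((u k)^-1 - 1) - (a k ^+ 2 * (1^-1 - 1)
      - t ^- 2 * (u k - 1))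
    = (1 - u k) / u k * ((t * a k) ^+ 2 - u k) / t ^+ 2.
    rewrite divr_ge0 ?sqr_ge0 // mulr_ge0 //.
      by rewrite divr_ge0 ?(ltW u0) // subr_ge0.
    by rewrite subr_ge0 (le_trans u1) // exprn_ege1.
  by field; rewrite !gt_eqF.
suff -> : a k ^+ 2 * ((u k)^-1 - 1) - (a k ^+ 2 * ((t * a k)^-1 - 1)
    - t ^- 2 * (u k - t * a k))
  = (u k - t * a k) ^+ 2 / (t ^+ 2 * u k).
  by rewrite divr_ge0 ?sqr_ge0 // mulr_ge0 ?sqr_ge0 // ltW.
by field; rewrite !gt_eqF.
Qed.

(** * Breakpoints and the piecewise linear parametrization *)

(** The least t >= 0 for which the levels of index below m are all saturated. *)
Definition breakpoint (m : nat) : R := if m is k.+1 then (a k)^-1 else 0.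

Lemma breakpoint_ge1 (m k : nat) :
  (k < m)%N -> (m <= N)%N -> 1 <= breakpoint m * a k.
Proof.
case: m => // m km mN /=.
by rewrite mulrC ler_pdivlMr ?mul1r ?a_gt0 // a_anti.
Qed.

Lemma breakpoint_le1 (m k : nat) :
  (m <= k.+1)%N -> (k < N)%N -> breakpoint m * a k <= 1.
Proof.
case: m => [|m] mk kN /=; first by rewrite mul0r.
rewrite mulrC ler_pdivrMr ?mul1r ?a_anti ?a_gt0 //.
exact: leq_ltn_trans kN.
Qed.

Lemma breakpoint_gt0 (m : nat) : (0 < m <= N)%N -> 0 < breakpoint m.
Proof. by case: m => //= m mN; rewrite invr_gt0 a_gt0. Qed.

(** The water-filling parameter of the AS distribution for
    eta = m - 1 + sigma. *)
Definition interp (m : nat) (sigma : R) : R :=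
  (1 - sigma) * breakpoint m + sigma * breakpoint m.+1.

Lemma interp_gt0 (m : nat) (sigma : R) : (m < N)%N -> 0 <= sigma < 1 ->
  (0 < m)%N || (0 < sigma) -> 0 < interp m sigma.
Proof.
move=> mN /andP[s0 s1] ms; have b1 := @breakpoint_gt0 m.+1 mN.
rewrite /interp.
have [m0|m0] := posnP m; last first.
  have b0 : 0 < breakpoint m by apply: breakpoint_gt0; rewrite m0 ltnW.
  by rewrite ltr_wpDr ?mulr_gt0 ?mulr_ge0 ?subr_gt0 // ltW.
by rewrite m0 /= in ms b1 *; rewrite mulr0 add0r mulr_gt0.
Qed.

Lemma level_ge (t : R) (k : nat) : 1 <= t * a k -> level t k = 1.
Proof. by move=> h; apply/min_idPl. Qed.

Lemma level_le (t : R) (k : nat) : t * a k <= 1 -> level t k = t * a k.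
Proof. by move=> h; apply/min_idPr. Qed.

Section Interpolation.
Variables (m : nat) (sigma : R).
Hypotheses (mN : (m < N)%N) (sigmaP : 0 <= sigma < 1).

Lemma interp_ge1 (k : nat) : (k < m)%N -> 1 <= interp m sigma * a k.
Proof.
move=> km; have /andP[s0 s1] := sigmaP.
have := breakpoint_ge1 km (ltnW mN).
have := @breakpoint_ge1 m.+1 k (ltnW km) mN.
by rewrite /interp => b1 b0; nra.
Qed.

Lemma interp_le1 (k : nat) : (m <= k < N)%N -> interp m sigma * a k <= 1.
Proof.
move=> /andP[mk kN]; have /andP[s0 s1] := sigmaP.
have := breakpoint_le1 (leqW mk) kN.
have := @breakpoint_le1 m.+1 k mk kN.
by rewrite /interp => b1 b0; nra.
Qed.

(** No level becomes saturated strictly between consecutive breakpoints: those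
    below m already are, and the others stay linear in t. *)
Lemma level_interp (k : nat) : (k < N)%N ->
  level (interp m sigma) k =
  (1 - sigma) * level (breakpoint m) k + sigma * level (breakpoint m.+1) k.
Proof.
move=> kN; case: (ltnP k m) => [km|mk].
  rewrite !level_ge ?interp_ge1 ?breakpoint_ge1 ?(ltnW mN) ?(leqW km) //.
  by ring.
rewrite !level_le ?interp_le1 ?breakpoint_le1 ?mk ?(leqW mk) //.
by rewrite /interp; ring.
Qed.

End Interpolation.

(** The sum of the levels goes from 0 at breakpoint 0 to N at breakpoint N
    and is linear in sigma in between, so C can be reached by solving a linear
    equation on the first segment that ends above C. *)
Lemma exists_interp_sum (C : R) : 0 < C -> C < N%:R ->
  exists m sigma, [/\ (m < N)%N, 0 <= sigma < 1, (0 < m)%N || (0 < sigma)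
    & \sum_(0 <= k < N) level (interp m sigma) k = C].
Proof.
move=> C0 CN; pose G m := \sum_(0 <= k < N) level (breakpoint m) k.
have G0 : G 0 = 0.
  by apply: big1 => k _; rewrite level_le mul0r.
have GN : G N = N%:R.
  rewrite /G big_nat (eq_bigr (fun=> 1)) -?big_nat ?sumr_const_nat ?subn0 //.
  by move=> k /andP[_ kN]; rewrite level_ge // breakpoint_ge1.
have exG : exists m, C < G m by exists N; rewrite GN.
case: (ex_minnP exG) => [[|m]]; first by rewrite G0 ltNge (ltW C0).
move=> CGm minm.
have mN : (m < N)%N by apply: minm; rewrite GN.
have GmC : G m <= C by rewrite leNgt; apply/negP => /minm; rewrite ltnn.
have dG : 0 < G m.+1 - G m by rewrite subr_gt0 (le_lt_trans GmC).
pose sigma := (C - G m) / (G m.+1 - G m).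
have sP : 0 <= sigma < 1.
  rewrite divr_ge0 ?subr_ge0 ?(ltW dG) ?(ltW (le_lt_trans GmC CGm)) //=.
  by rewrite ltr_pdivrMr // mul1r ltrD2r.
exists m, sigma; split => //.
  by case: (posnP m) => //= m0; rewrite divr_gt0 // subr_gt0 m0 G0.
rewrite big_nat; under eq_bigr => k /andP[_ kN] do rewrite level_interp //.
rewrite -big_nat big_split /= -!mulr_sumr -/(G m) -/(G m.+1) /sigma.
by field; rewrite gt_eqF.
Qed.

End WaterFilling.

(** * The AS distributions are the water-filling distributions *)

(** The definition of the AS distribution sets 1 - P(m) = t a_m, and then
    divides what remains proportionally to the differences of the a_k, which is
    the increment t a_(j-1) - t a_j of unsaturated levels. *)
Lemma as_distribution_waterfill (R : realType) (N : nat) (alpha q : nat -> R)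
    (m : nat) (sigma : R) (a := fun k => alpha k * q k) :
  (forall k, (k < N)%N -> 0 < a k) ->
  (forall j k, (j <= k)%N -> (k < N)%N -> a k <= a j) ->
  (m < N)%N -> 0 <= sigma < 1 -> forall j, (j <= N)%N ->
  as_distribution N alpha q (m%:R - 1 + sigma) j
  = waterfill N a (interp a m sigma) j.
Proof.
move=> a_gt0 a_anti mN sP j jN; have am := a_gt0 _ mN.
have fl : Num.floor (m%:R - 1 + sigma) = m%:Z - 1.
  apply: floor_def; rewrite subrK rmorphB /= -!pmulrn.
  by lra.
rewrite /as_distribution fl subrK rmorphB /= -!pmulrn.
have -> : m%:R - 1 + sigma - (m%:R - 1) = sigma by ring.
have -> : (m%:Z - 1 == -1) = (m == 0%N).
  by rewrite -[eqbRHS]sub0r (inj_eq (addIr _)).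
set Pm := (if m == 0%N then _ else _).
have PmE : 1 - Pm = interp a m sigma * a m.
  rewrite /Pm /interp; case: (m) am (mN) => [|m'] am' mN'.
    by rewrite /=; field; rewrite gt_eqF.
  have am'' : 0 < a m' by apply: a_gt0; apply: ltnW.
  by rewrite /= -/(a m') -/(a m'.+1); field; rewrite !gt_eqF.
have lo := interp_ge1 a_gt0 a_anti mN sP.
have hi := interp_le1 a_gt0 a_anti sP.
(* Up to m the levels are saturated; from m on they are linear. *)
have before k : (k <= m)%N -> level_ext N a (interp a m sigma) k = 1.
  case: k => //= k km; rewrite (ltn_trans km mN) level_ge //; exact: lo.
have after k : (m <= k < N)%N ->
    level_ext N a (interp a m sigma) k.+1 = interp a m sigma * a k.
  by move=> /[dup] /andP[_ kN] /hi h /=; rewrite kN level_le.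
rewrite /waterfill; case: (ltngtP j m) => [jm|mj|->].
- by rewrite !before ?subrr // ltnW.
- case: j mj jN => // j mj jN; rewrite PmE /=.
  rewrite -/(level_ext N a _ j.+1) after ?jN ?andbT //.
  rewrite -/(a j) -/(a j.+1) -/(a m).
  case: (ltnP j.+1 N) => [j1N|Nj]; last first.
    have -> : N.-1 = j by rewrite (@anti_leq N j.+1) ?Nj.
    by rewrite -/(a j); field; rewrite gt_eqF.
  rewrite level_le ?hi ?j1N ?andbT ?(ltnW mj) //.
  by field; rewrite gt_eqF.
- by rewrite before // after ?leqnn // -PmE; ring.
Qed.

(** The deterministic method is included: at the last breakpoint all levels are
    saturated. *)
Lemma is_as_distribution_waterfill (R : realType) (N : nat)
    (alpha q P : nat -> R) (a := fun k => alpha k * q k) :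
  (0 < N)%N -> (forall k, (k < N)%N -> 0 < a k) ->
  (forall j k, (j <= k)%N -> (k < N)%N -> a k <= a j) ->
  is_as_distribution N alpha q P ->
  exists2 t, 0 < t & forall j, (j <= N)%N -> P j = waterfill N a t j.
Proof.
move=> N0 a_gt0 a_anti [[eta [eta_gt eta_lt PE]]|PE].
  pose m := absz (Num.floor eta + 1); pose sigma := eta - (m%:R - 1).
  have /andP[fl1 fl2] := floor_itv eta.
  have n1 : -1 <= Num.floor eta by rewrite floor_ge_int ltW.
  have mE : m%:Z = Num.floor eta + 1.
    by rewrite /m gez0_abs // -lerBlDr sub0r.
  have flE : (Num.floor eta)%:~R = m%:R - 1 :> R.
    by rewrite (pmulrn 1 m) mE rmorphD /= addrK.
  rewrite rmorphD /= flE in fl1 fl2.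
  have sP : 0 <= sigma < 1 by rewrite /sigma; lra.
  have mN : (m < N)%N by rewrite -(ltr_nat R); lra.
  exists (interp a m sigma).
    apply: (interp_gt0 a_gt0 mN sP); case: (posnP m) => //= m0.
    by rewrite /sigma m0; lra.
  move=> j jN; rewrite PE // -as_distribution_waterfill //.
  by congr (as_distribution _ _ _ _); rewrite /sigma; ring.
exists (breakpoint a N); first by rewrite (breakpoint_gt0 a_gt0) ?N0 ?leqnn.
have one k : (k <= N)%N -> level_ext N a (breakpoint a N) k = 1.
  by case: k => //= k kN; rewrite kN level_ge // (breakpoint_ge1 a_gt0).
move=> j jN; rewrite PE // /waterfill one //.
move: jN; rewrite leq_eqVlt => /predU1P[->|jN].
  by rewrite eqxx /= ltnn subr0.
by rewrite one // subrr ltn_eqF.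
Qed.

(** * Optimality *)

Lemma waterfill_global_minimizer (R : realType) (N : nat)
    (alpha q P : nat -> R) (t : R) (a := fun k => alpha k * q k) :
  (0 < N)%N -> (forall k, (k < N)%N -> 0 < a k) ->
  (forall j k, (j <= k)%N -> (k < N)%N -> a k <= a j) ->
  0 < t -> (forall j, (j <= N)%N -> P j = waterfill N a t j) ->
  global_minimizer N alpha q (avg_iterations N P) P.
Proof.
move=> N0 a_gt0 a_anti t0 PE.
have P1 : \sum_(0 <= j < N.+1) P j = 1.
  rewrite (eq_big_nat _ _ (F2 := waterfill N a t)) // sum_waterfill /=.
  by rewrite ltnn subr0.
have P0 j : (j <= N)%N -> 0 <= P j.
  by move=> jN; rewrite PE // waterfill_ge0 // ltW.
have sP k : (k < N)%N -> survival P k = level a t k.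
  move=> kN; rewrite -(survival_waterfill a t kN) /survival.
  congr (1 - _); apply: eq_big_nat => i /andP[_ ik]; apply: PE.
  exact: leq_trans (ltnW kN).
have PN : P N != 0.
  (* P(N) is the last level, so the objective at P is finite. *)
  rewrite PE // /waterfill /= ltnn subr0 -(prednK N0) /= prednK // leqnn gt_eqF //.
  by rewrite (level_gt0 a_gt0) // prednK.
split=> [|Q [Qavg Q1 Q0]]; first by split.
have [QN|QN] := eqVneq (Q N) 0; first by rewrite [leRHS]/objective QN eqxx leey.
rewrite !objectiveE // lee_fin.
rewrite (eq_big_nat _ _ (F2 := fun k => a k ^+ 2 * ((level a t k)^-1 - 1))); last first.
  by move=> k /andP[_ kN]; rewrite sP.
apply: (waterfill_optimal a_gt0 t0) => [k kN|].
  by rewrite (survival_gt0 Q1 Q0 QN kN) (survival_le1 Q0) // ltnW.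
rewrite -avg_iterations_survival // Qavg avg_iterations_survival //.
by apply: eq_big_nat => k /andP[_ kN]; exact: sP.
Qed.

Theorem theorem2p3 (R : realType) (N : nat) (hN : (1 <= N)%N)
    (method : krylov_method R N)
    (hpos : forall j : nat, (j < N)%N -> 0 < step_size method j * q_norm method j)
    (hdim : forall j : nat, (1 <= j < N)%N ->
       step_size method j ^+ 2 * q_norm method j ^+ 2
       < step_size method j.-1 ^+ 2 * q_norm method j.-1 ^+ 2)
    (C : R) (hC0 : 0 < C) (hCN : C <= N%:R) :
  (exists P : nat -> R,
     is_as_distribution N (step_size method) (q_norm method) P
     /\ avg_iterations N P = C)
  /\ (forall P : nat -> R,
        is_as_distribution N (step_size method) (q_norm method) P ->
        avg_iterations N P = C ->
        global_minimizer N (step_size method) (q_norm method) C P).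
Proof.
pose a k := step_size method k * q_norm method k.
have a_anti j k : (j <= k)%N -> (k < N)%N -> a k <= a j.
  elim: k => [|k IHk]; first by rewrite leqn0 => /eqP->.
  rewrite leq_eqVlt => /predU1P[->//|jk] kN.
  apply: le_trans (IHk jk (ltnW kN)); have := @hdim k.+1 kN.
  rewrite -!exprMn /= => /ltW.
  by rewrite ler_pXn2r // nnegrE ltW // hpos // ltnW.
split=> [|P PAS <-]; last first.
  have [t t0 PE] := is_as_distribution_waterfill hN hpos a_anti PAS.
  exact: waterfill_global_minimizer PE.
move: hCN; rewrite le_eqVlt => /predU1P[->|CN].
  exists (fun j => (j == N)%:R); split; first by right.
  rewrite /avg_iterations big_nat_recr //= eqxx mulr1 big_nat big1 ?add0r //.
  by move=> j /andP[_ jN]; rewrite ltn_eqF // mulr0.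
have [m [sigma [mN sP ms sumC]]] := exists_interp_sum hpos a_anti hC0 CN.
exists (as_distribution N (step_size method) (q_norm method) (m%:R - 1 + sigma)).
split.
  left; exists (m%:R - 1 + sigma); split=> //; have /andP[s0 s1] := sP.
    have [m1|s1'] := orP ms.
      have : 1 <= m%:R :> R by rewrite ler1n.
      by lra.
    have : 0 <= m%:R :> R by [].
    by lra.
  have : m.+1%:R <= N%:R :> R by rewrite ler_nat.
  by rewrite -natr1; lra.
rewrite /avg_iterations; under eq_big_nat => j /andP[_ jN]
  do rewrite (as_distribution_waterfill hpos a_anti mN sP jN).
rewrite -/(avg_iterations N _) avg_iterations_survival; last first.
  by rewrite sum_waterfill /= ltnn subr0.
by rewrite -sumC; apply: eq_big_nat => k /andP[_ kN]; exact: survival_waterfill.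
Qed.
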